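(* Let $\mathcal{H}$ be a contextual family of ordered hypergraphs. For any $\mathbb{H}\in\mathcal{H}$ and any subset $X\subseteq H$ with $|X|=3$, all the $X$-faces of $\mathbb{H}$, and hence their associated overlapping local confluence diagrams, have the same shape $\mathbb{H}_{\cap X}$.
   Context: **Hypergraphs.** A hypergraph $\mathbb{H}$ consists of a finite set $H$ of vertices and a set $\mathbb{H}\subseteq\mathcal{P}(H)\setminus\{\emptyset\}$ of hyperedges with $\bigcup\mathbb{H}=H$; it is always assumed atomic, i.e. $\{x\}\in\mathbb{H}$ for all $x\in H$. It is ordered if $H$ carries a total order (inherited by restrictions). For $X\subseteq H$ put $\mathbb{H}_X=\{Z\in\mathbb{H}\mid Z\subseteq X\}$ and $\mathbb{H}\setminus X=\mathbb{H}_{H\setminus X}$. $\mathbb{H}$ is connected if $H\neq\emptyset$ and there is no partition $H=X_1\sqcup X_2$ into non-empty sets with $\mathbb{H}=\mathbb{H}_{X_1}\cup\mathbb{H}_{X_2}$. A non-empty $X\subseteq H$ is connected if $\mathbb{H}_X$ is. $\mathbb{H},X\leadsto H_1,\dots,H_n$ means that $H_1,\dots,H_n$ are the (vertex sets of the) connected components of $\mathbb{H}\setminus X$. $\mathrm{Sat}(\mathbb{H})$ is the set of connected subsets of $H$. The reconnected restriction is $\mathbb{H}_{\cap X}=\{Z\cap X\mid Z\in\mathrm{Sat}(\mathbb{H}),Z\cap X\neq\emptyset\}$. A connected hypergraph has dimension $|H|-1$; $\mathcal{H}(n)$ is the set of $n$-dimensional members of $\mathcal{H}$. **Constructs and $X$-faces.**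 Constructs of a connected hypergraph $\mathbb{H}$ are rooted trees defined inductively: the one-node tree decorated by $H$ is a construct; if $\emptyset\ne Y\subseteq H$, $\mathbb{H},Y\leadsto H_1,\dots,H_n$ and $T_i$ is a construct of $\mathbb{H}_{H_i}$ for each $i$, then the tree $Y(T_1,\dots,T_n)$ with root decorated by $Y$ is a construct. A construction is a construct with all nodes singletons. $S\prec T$ means that $T$ is obtained from $S$ by contracting an edge between a node and its child and labelling the resulting node by the union of the labels; constructs with $\prec^*$ are the faces of a polytope. For $X\subseteq H$ with $|X|=3$, an $X$-face of $\mathbb{H}$ is a construct $T$ whose unique non-singleton node is $X$. For a node $X$ of $T$, $T/X$ is the full subtree of $T$ rooted at $X$ and $\mathrm{supp}(T/X)$ is the union of the decorations of its nodes. The shape of an $X$-face $T$ is the hypergraph $(\mathbb{H}_{\mathrm{supp}(T/X)})_{\cap X}$. The overlapping local confluence diagram associated to an $X$-face $T$ is its boundary (the constructions and 1-dimensional constructs below $T$), each edge with non-singleton node $\{x,y\}$, $x<y$, being oriented from the construction where $y$ is a child of $x$ to the one where $x$ is a child of $y$; its shape is the shape of $T$. **Contextual hypergraphs and families.** A connected hypergraph $\mathbb{H}$ is contextual if for all connected $Y\subseteq H$ with $|Y|\ge3$ and all 3-element $X\subseteq Y$ one has $\mathbb{H}_{\cap X}=(\mathbb{H}_Y)_{\cap X}$. A family $\mathcal{H}$ of ordered hypergraphs is contextual if: (1) every $\mathbb{H}\in\mathcal{H}$ is contextual; (2) for every $\mathbb{H}\in\mathcal{H}$ and $X\subseteq H$,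 all connected components of $\mathbb{H}\setminus X$ are in $\mathcal{H}$; (3) $\{\mathbb{H}_{\cap X}\mid \mathbb{H}\in\mathcal{H},\ X\subseteq H,\ |X|=3\}\subseteq\mathcal{H}(2)$. *)

(* Defs.v *)
From HB Require Import structures.
From Stdlib Require List.
From Stdlib Require Import Relation_Operators.
From mathcomp Require Import all_boot finmap.

Set Implicit Arguments.
Unset Strict Implicit.
Unset Printing Implicit Defensive.

Local Open Scope fset_scope.

(* Vertices live in an arbitrary choiceType K.  The records below hold raw
   data; the axioms are the predicates [is_hypergraph] and
   [is_ordered_hypergraph].  All fields are finite sets, so Leibniz equality
   of records is equality of (ordered) hypergraphs. *)

Record hypergraph (K : choiceType) := Hypergraph {
  verts : {fset K};
  edges : {fset {fset K}}
}.

Definition is_hypergraph {K : choiceType} (H : hypergraph K) : Prop :=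
  [/\ forall Z, Z \in edges H -> Z `<=` verts H /\ Z != fset0,
      (\bigcup_(Z <- edges H) Z) = verts H &
      forall x, x \in verts H -> [fset x] \in edges H].

(* H_X; it is only used for X included in the vertex set. *)
Definition restrict {K : choiceType} (H : hypergraph K) (X : {fset K}) :=
  Hypergraph X [fset Z in edges H | Z `<=` X].

(* H \ X *)
Definition remove {K : choiceType} (H : hypergraph K) (X : {fset K}) :=
  restrict H (verts H `\` X).

Definition connected {K : choiceType} (H : hypergraph K) : bool :=
  (verts H != fset0) &&
  ~~ has (fun X1 : {fset K} => has (fun X2 : {fset K} =>
       [&& X1 != fset0, X2 != fset0, X1 `&` X2 == fset0,
           X1 `|` X2 == verts H &
           edges H == edges (restrict H X1) `|` edges (restrict H X2)])
     (fpowerset (verts H))) (fpowerset (verts H)).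

Lemma connectedP {K : choiceType} (H : hypergraph K) :
  reflect (verts H <> fset0 /\
           ~ exists X1 X2 : {fset K},
               [/\ X1 <> fset0, X2 <> fset0, X1 `&` X2 = fset0,
                   X1 `|` X2 = verts H &
                   edges H = edges (restrict H X1) `|` edges (restrict H X2)])
          (connected H).
Proof.
apply: (iffP andP) => [[/eqP V0 nP]|[V0 nP]]; split=> //.
- move=> [X1 [X2 [n1 n2 d u e]]]; case/negP: nP.
  have s1 : X1 \in fpowerset (verts H) by rewrite fpowersetE -u fsubsetUl.
  have s2 : X2 \in fpowerset (verts H) by rewrite fpowersetE -u fsubsetUr.
  apply/hasP; exists X1 => //; apply/hasP; exists X2 => //.
  by apply/and5P; split; [apply/eqP|apply/eqP|rewrite d|rewrite u|rewrite -e].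
- exact/eqP.
- apply/negP=> /hasP[X1 _ /hasP[X2 _ /and5P[/eqP n1 /eqP n2 /eqP d /eqP u /eqP e]]].
  by apply: nP; exists X1, X2.
Qed.

(* The set of connected subsets of H. *)
Definition Sat {K : choiceType} (H : hypergraph K) : {fset {fset K}} :=
  [fset X in fpowerset (verts H) | connected (restrict H X)].

(* The vertex sets of the connected components: the maximal connected subsets. *)
Definition components {K : choiceType} (H : hypergraph K) : {fset {fset K}} :=
  [fset C in Sat H | all (fun D => ~~ (C `<` D)) (Sat H)].

(* H_{\cap X} *)
Definition reconnect {K : choiceType} (H : hypergraph K) (X : {fset K}) :=
  Hypergraph X [fset Z in [fset Y `&` X | Y in Sat H] | Z != fset0].

Definition dim {K : choiceType} (H : hypergraph K) : nat := #|` verts H|.-1.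

(* The order is stored as its graph, a subset of the square of the vertex set. *)
Record ohypergraph (K : choiceType) := OHypergraph {
  under :> hypergraph K;
  vorder : {fset K * K}
}.

Definition ole {K : choiceType} (H : ohypergraph K) : rel K :=
  fun x y => (x, y) \in vorder H.

Definition is_ordered_hypergraph {K : choiceType} (H : ohypergraph K) : Prop :=
  is_hypergraph H /\
  [/\ forall x y, ole H x y -> x \in verts H /\ y \in verts H,
      {in verts H &, total (ole H)},
      {in verts H &, antisymmetric (ole H)} &
      {in verts H & &, transitive (ole H)}].

Definition order_restrict {K : choiceType} (H : ohypergraph K) (X : {fset K}) :
    {fset K * K} :=
  [fset p in vorder H | (p.1 \in X) && (p.2 \in X)].

Definition orestrict {K : choiceType} (H : ohypergraph K) (X : {fset K}) :=
  OHypergraph (restrict H X) (order_restrict H X).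

Definition oremove {K : choiceType} (H : ohypergraph K) (X : {fset K}) :=
  orestrict H (verts H `\` X).

Definition oreconnect {K : choiceType} (H : ohypergraph K) (X : {fset K}) :=
  OHypergraph (reconnect H X) (order_restrict H X).

(* Trees are planar here, while the trees of the theory are not: [tree_eqv]
   identifies those that differ by the order of the children. *)
Inductive tree (K : choiceType) : Type :=
  Node of {fset K} & seq (tree K).

Definition label {K : choiceType} (T : tree K) : {fset K} :=
  let: Node A _ := T in A.

Definition children {K : choiceType} (T : tree K) : seq (tree K) :=
  let: Node _ ts := T in ts.

(* All full subtrees T/Y, one for each node of T. *)
Fixpoint subtrees {K : choiceType} (T : tree K) : seq (tree K) :=
  let: Node A ts := T in T :: flatten (map subtrees ts).

Definition labels {K : choiceType} (T : tree K) : seq {fset K} :=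
  map label (subtrees T).

Definition supp {K : choiceType} (T : tree K) : {fset K} :=
  \bigcup_(A <- labels T) A.

(* T/X.  The nodes of a construct have pairwise distinct labels, so a node is
   given by its label; T itself is a default value when X is not a node. *)
Definition subtree_at {K : choiceType} (T : tree K) (X : {fset K}) : tree K :=
  head T [seq S <- subtrees T | label S == X].

Definition is_child {K : choiceType} (T : tree K) (A B : {fset K}) : bool :=
  has (fun S => (label S == A) && (B \in map label (children S))) (subtrees T).

Inductive tree_eqv {K : choiceType} : tree K -> tree K -> Prop :=
| tree_eqv_refl T : tree_eqv T T
| tree_eqv_trans S T U : tree_eqv S T -> tree_eqv T U -> tree_eqv S U
| tree_eqv_swap A l s t r :
    tree_eqv (Node A (l ++ s :: t :: r)) (Node A (l ++ t :: s :: r))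
| tree_eqv_child A l s t r :
    tree_eqv s t -> tree_eqv (Node A (l ++ s :: r)) (Node A (l ++ t :: r)).

(* In the second clause, cs lists the children of the root together with the
   components they are constructs of. *)
Inductive construct {K : choiceType} : hypergraph K -> tree K -> Prop :=
| construct_one H :
    connected H -> construct H (Node (verts H) [::])
| construct_node H Y (cs : seq ({fset K} * tree K)) :
    connected H -> Y != fset0 -> Y `<=` verts H ->
    perm_eq [seq c.1 | c <- cs] (components (remove H Y)) ->
    (forall C T, List.In (C, T) cs -> construct (restrict H C) T) ->
    construct H (Node Y [seq c.2 | c <- cs]).

Definition construction {K : choiceType} (H : hypergraph K) (T : tree K) : Prop :=
  construct H T /\ all (fun A : {fset K} => #|` A| == 1) (labels T).

(* The labels of the non-singleton nodes, with multiplicity. *)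
Definition big_labels {K : choiceType} (T : tree K) : seq {fset K} :=
  [seq A <- labels T | #|` A| != 1].

Definition Xface {K : choiceType} (H : hypergraph K) (X : {fset K}) (T : tree K) :
    Prop :=
  [/\ X `<=` verts H, #|` X| = 3, construct H T & big_labels T = [:: X]].

Inductive contract {K : choiceType} : tree K -> tree K -> Prop :=
| contract_root A B l ts r :
    contract (Node A (l ++ Node B ts :: r)) (Node (A `|` B) (l ++ ts ++ r))
| contract_child A l s t r :
    contract s t -> contract (Node A (l ++ s :: r)) (Node A (l ++ t :: r)).

(* S \prec T, on trees up to the order of the children. *)
Definition prec {K : choiceType} (S T : tree K) : Prop :=
  exists S' T', [/\ tree_eqv S S', contract S' T' & tree_eqv T' T].

(* S \prec^* T between constructs of H *)
Definition below {K : choiceType} (H : hypergraph K) (S T : tree K) : Prop :=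
  construct H S /\ clos_refl_trans _ prec S T.

(* The dimension of a face of the polytope of H. *)
Definition face_dim {K : choiceType} (H : hypergraph K) (T : tree K) : nat :=
  #|` verts H| - size (labels T).

Definition face_shape {K : choiceType} (H : ohypergraph K) (X : {fset K}) (T : tree K) :
    ohypergraph K :=
  oreconnect (orestrict H (supp (subtree_at T X))) X.

(* A diagram is a set of vertices, a set of edges, and the orientation of
   these edges: [dg_arrow D e s t] says that e goes from s to t.  It records
   the face of which it is the boundary. *)
Record diagram (K : choiceType) := Diagram {
  dg_ambient : ohypergraph K;
  dg_center : {fset K};
  dg_face : tree K;
  dg_vertex : tree K -> Prop;
  dg_edge : tree K -> Prop;
  dg_arrow : tree K -> tree K -> tree K -> Prop
}.

Definition oriented {K : choiceType} (H : ohypergraph K) (e s t : tree K) : Prop :=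
  exists x y : K,
    [/\ x != y /\ ole H x y, big_labels e = [:: [fset x; y]],
        construction H s /\ construction H t,
        prec s e /\ is_child s [fset x] [fset y] &
        prec t e /\ is_child t [fset y] [fset x]].

Definition confluence_diagram {K : choiceType} (H : ohypergraph K) (X : {fset K})
    (T : tree K) : diagram K :=
  let edge e := below H e T /\ face_dim H e = 1 in
  {| dg_ambient := H;
     dg_center := X;
     dg_face := T;
     dg_vertex := fun s => construction H s /\ below H s T;
     dg_edge := edge;
     dg_arrow := fun e s t => edge e /\ oriented H e s t |}.

(* The shape of a diagram is, by definition, the shape of its face. *)
Definition diagram_shape {K : choiceType} (D : diagram K) : ohypergraph K :=
  face_shape (dg_ambient D) (dg_center D) (dg_face D).

Definition contextual {K : choiceType} (H : hypergraph K) : Prop :=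
  connected H /\
  forall Y, Y \in Sat H -> 3 <= #|` Y| ->
  forall X : {fset K}, X `<=` Y -> #|` X| = 3 ->
  reconnect H X = reconnect (restrict H Y) X.

Definition family_dim {K : choiceType} (F : ohypergraph K -> Prop) (n : nat) :
    ohypergraph K -> Prop :=
  fun H => F H /\ dim H = n.

Definition contextual_family {K : choiceType} (F : ohypergraph K -> Prop) : Prop :=
  [/\ forall H, F H -> is_ordered_hypergraph H,
      forall H, F H -> contextual H,
      forall H X C, F H -> X `<=` verts H ->
        C \in components (oremove H X) -> F (orestrict (oremove H X) C) &
      forall H X, F H -> X `<=` verts H -> #|` X| = 3 ->
        family_dim F 2 (oreconnect H X)].

(* Main.v *)
Require Import Defs.
From Stdlib Require List.
From mathcomp Require Import all_boot finmap.

Local Open Scope fset_scope.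

(** The face [T] enters its shape only through the vertex set
    [S := supp (subtree_at T X)].  Contextuality says that [H] and its
    restriction to a connected set containing [X] have the same reconnected
    restriction to [X], so it suffices that [S] is connected and contains [X].

    It contains [X] because [X] is the label of a node of [T].  It is connected
    because every full subtree of a construct of [H] is itself a construct of
    some [restrict H C] with [C] connected, and its support is all of [C]: the
    components of what remains once the root label is removed cover exactly the
    remaining vertices ([bigcup_components]).  The lemma [construct_supp]
    carries out this induction.

    The ordering of the shape is the ordering of [H] cut down to [X], and
    cutting down to [S] beforehand does not change it. *)

Lemma restrict_restrict (K : choiceType) (H : hypergraph K) (A B : {fset K}) :
  B `<=` A -> restrict (restrict H A) B = restrict H B.
Proof.
move=> sBA; congr Hypergraph; apply/fsetP=> Z; rewrite !inE /=.
case sZB: (Z `<=` B); last by rewrite !andbF.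
by rewrite (fsubset_trans sZB sBA) !andbT.
Qed.

Lemma restrict_verts (K : choiceType) (H : hypergraph K) :
  (forall Z, Z \in edges H -> Z `<=` verts H) -> restrict H (verts H) = H.
Proof.
case: H => V E /= sEV; congr Hypergraph; apply/fsetP=> Z; rewrite !inE /=.
by case ZE: (Z \in E); rewrite //= sEV.
Qed.

Lemma order_restrict_restrict (K : choiceType) (H : ohypergraph K)
    (A B : {fset K}) :
  B `<=` A -> order_restrict (orestrict H A) B = order_restrict H B.
Proof.
move=> /fsubsetP sBA; apply/fsetP=> p; rewrite !inE /=.
case pB: ((p.1 \in B) && (p.2 \in B)); last by rewrite !andbF.
by case/andP: pB => /sBA -> /sBA ->; rewrite !andbT.
Qed.

Lemma in_Sat (K : choiceType) (H : hypergraph K) (A : {fset K}) :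
  (A \in Sat H) = (A `<=` verts H) && connected (restrict H A).
Proof. by rewrite !inE /= fpowersetE. Qed.

Lemma in_components (K : choiceType) (H : hypergraph K) (C : {fset K}) :
  (C \in components H) =
  (C \in Sat H) && all (fun D => ~~ (C `<` D)) (Sat H).
Proof. by rewrite !inE. Qed.

Lemma Sat_restrict (K : choiceType) (H : hypergraph K) (A B : {fset K}) :
  A `<=` verts H -> B \in Sat (restrict H A) -> B \in Sat H.
Proof.
move=> sAH; rewrite !in_Sat /= => /andP[sBA].
by rewrite restrict_restrict // (fsubset_trans sBA sAH).
Qed.

(** A one-element set has no partition into two non-empty parts, whether or not
    it is a hyperedge. *)
Lemma Sat1 (K : choiceType) (H : hypergraph K) (x : K) :
  x \in verts H -> [fset x] \in Sat H.
Proof.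
move=> xH; rewrite in_Sat fsub1set xH /=; apply/connectedP; split=> /=.
  by move/fsetP/(_ x); rewrite !inE eqxx.
case=> A [B] [/eqP nA /eqP nB dAB uAB _].
have [sA sB] : A `<=` [fset x] /\ B `<=` [fset x].
  by rewrite -uAB fsubsetUl fsubsetUr.
move: sA sB dAB nA nB; rewrite !fsubset1.
case/orP=> /eqP->; last by rewrite eqxx.
case/orP=> /eqP->; last by rewrite eqxx.
by rewrite fsetIid => ->; rewrite eqxx.
Qed.

Lemma Sat_sub_component (K : choiceType) (H : hypergraph K) (D : {fset K}) :
  D \in Sat H -> exists2 C, C \in components H & D `<=` C.
Proof.
(* Enlarging D decreases the number of vertices outside of D. *)
have [n] := ubnP #|` verts H `\` D|; elim: n D => // n IHn D leDn DH.
have [maxD|/allPn[E EH]] := boolP (all (fun E => ~~ (D `<` E)) (Sat H)).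
  by exists D; rewrite // in_components DH.
rewrite negbK => ltDE.
have [|//|C CH sEC] := IHn E; last first.
  by exists C; rewrite // (fsubset_trans _ sEC) ?fproper_sub.
have /andP[sEH _] : (E `<=` verts H) && connected (restrict H E).
  by rewrite -in_Sat.
have sDH := fsubset_trans (fproper_sub ltDE) sEH.
have ltcDE := fproper_ltn_card ltDE.
move: leDn; rewrite ltnS; apply: leq_trans; rewrite !cardfsDS //.
by rewrite ltn_sub2l // (leq_trans ltcDE) ?fsubset_leq_card.
Qed.

Lemma bigcup_components (K : choiceType) (H : hypergraph K) :
  \bigcup_(C <- components H) C = verts H.
Proof.
apply/fsetP=> x; apply/bigfcupP/idP => [[C]|xH].
  by rewrite andbT in_components in_Sat => /andP[/andP[/fsubsetP sCH _] _] /sCH.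
have [C CH] := Sat_sub_component _ _ _ (Sat1 _ _ _ xH).
by rewrite fsub1set => xC; exists C; rewrite ?CH.
Qed.

Lemma supp_Node (K : choiceType) (A : {fset K}) (ts : seq (tree K)) :
  supp (Node A ts) = A `|` \bigcup_(t <- ts) supp t.
Proof.
rewrite /supp /labels /= big_cons map_flatten big_flatten -map_comp.
by rewrite big_map.
Qed.

Lemma label_sub_supp (K : choiceType) (T : tree K) : label T `<=` supp T.
Proof. by case: T => A ts; rewrite supp_Node fsubsetUl. Qed.

Lemma all_In (A : Type) (p : pred A) (s : seq A) :
  (forall x, List.In x s -> p x) -> all p s.
Proof.
elim: s => //= x s IHs ps; rewrite ps ?IHs //; last by left.
by move=> y ys; apply: ps; right.
Qed.

Lemma all_flatten (A : Type) (p : pred A) (ss : seq (seq A)) :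
  all p (flatten ss) = all (all p) ss.
Proof. by elim: ss => //= s ss <-; rewrite all_cat. Qed.

(** The two conclusions are proved together: that the root has connected
    support rests on this support being the whole vertex set, and the latter is
    an induction over the children.  The condition on hyperedges makes [H] equal
    to [restrict H (verts H)]: a hyperedge leaving the vertex set would be lost
    in the restriction, which could then fail to be connected. *)
Lemma construct_supp (K : choiceType) (H : hypergraph K) (T : tree K) :
    construct H T -> (forall Z, Z \in edges H -> Z `<=` verts H) ->
  supp T = verts H /\ all (fun S => supp S \in Sat H) (subtrees T).
Proof.
elim=> {H T} [H conH|H Y cs conH _ sYH eqcs _ IHcs] sEV.
  have suppT : supp (Node (verts H) [::]) = verts H.
    by rewrite supp_Node big_nil fsetU0.
  by rewrite /= suppT in_Sat fsubset_refl restrict_verts ?conH.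
have sEC C Z : Z \in edges (restrict H C) -> Z `<=` verts (restrict H C).
  by rewrite !inE /= => /andP[].
have supp_cs : [seq supp c.2 | c <- cs] = [seq c.1 | c <- cs].
  apply: List.map_ext_in => -[C T] /IHcs IH.
  by have [] := IH (sEC C).
have suppT : supp (Node Y [seq c.2 | c <- cs]) = verts H.
  rewrite supp_Node big_map -(big_map (fun c => supp c.2) xpredT id) supp_cs.
  rewrite (perm_big _ eqcs) bigcup_components /=.
  apply/fsetP=> x; rewrite !inE.
  by have [/(fsubsetP sYH)|] := boolP (x \in Y).
split=> //=; rewrite suppT in_Sat fsubset_refl restrict_verts // conH /=.
have scs C : C \in [seq c.1 | c <- cs] -> C `<=` verts H.
  rewrite (perm_mem eqcs) in_components in_Sat /= => /andP[/andP[sC _] _].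
  exact: fsubset_trans sC (fsubsetDl _ _).
rewrite all_flatten !all_map; apply: all_In => -[C T] csCT /=.
have [_] := IHcs C T csCT (sEC C).
apply: sub_all => S; apply: Sat_restrict; apply: scs.
elim: cs csCT {IHcs supp_cs suppT eqcs} => //= c cs IHcs [->|/IHcs inC].
  by rewrite inE eqxx.
by rewrite inE inC orbT.
Qed.

(** A label of [T] is found among the subtrees, so that [subtree_at] does not
    fall back on [T] itself. *)
Lemma all_subtree_at (K : choiceType) (p : pred (tree K)) (T : tree K)
    (X : {fset K}) :
  X \in labels T -> all p (subtrees T) ->
  p (subtree_at T X) /\ label (subtree_at T X) = X.
Proof.
rewrite /labels /subtree_at; elim: (subtrees T) => //= S s IHs.
rewrite inE eq_sym; case: eqP => [<- _ /andP[pS _]|_ /= Xs /andP[_ ps]] //.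
exact: IHs.
Qed.

Theorem theorem4p7 (K : choiceType) (F : ohypergraph K -> Prop) :
  contextual_family F ->
  forall (H : ohypergraph K) (X : {fset K}),
    F H -> X `<=` verts H -> #|` X| = 3 ->
  forall T : tree K, Xface H X T ->
    face_shape H X T = oreconnect H X /\
    diagram_shape (confluence_diagram H X T) = oreconnect H X.
Proof.
case=> hypF ctxF _ _ H X FH _ X3 T [_ _ cT bigT].
suff shapeT : face_shape H X T = oreconnect H X by [].
have [[edgesH _ _] _] := hypF H FH.
have [_ allT] := construct_supp _ _ _ cT (fun Z ZH => proj1 (edgesH Z ZH)).
have XT : X \in labels T.
  suff : X \in big_labels T by rewrite mem_filter => /andP[].
  by rewrite bigT inE.
have [SatS labelS] := all_subtree_at _ _ _ _ XT allT.
have sXS : X `<=` supp (subtree_at T X).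
  by rewrite -{1}labelS label_sub_supp.
have [_ ctxH] := ctxF H FH.
rewrite /face_shape /oreconnect order_restrict_restrict //=.
by rewrite -(ctxH _ SatS) // -X3 fsubset_leq_card.
Qed.
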